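(* Let $1\leq p<\infty$ and let $T$ be a simplicial tree. For every increasing function $f:\mathbb{R}_+\to\mathbb{R}_+$ satisfying $$\int_1^{\infty}\left(\frac{f(t)}{t}\right)^p\frac{dt}{t}<\infty,$$ there exists a uniform embedding $F$ of $T$ into $\ell^p(T)$ with compression $\rho\succeq f$.
   Context: A simplicial tree is a tree in which every edge has length $1$; vertices may have infinite degree (no local finiteness is assumed). $T$ is identified with its vertex set, equipped with the tree distance, and $\ell^p(T)$ is the $\ell^p$-space on the vertex set. A map $F:X\to Y$ between metric spaces is a uniform embedding if $d_X(x,y)\to\infty \Longleftrightarrow d_Y(F(x),F(y))\to\infty$ (for sequences of pairs of points). Its compression is $\rho(t)=\inf_{d_X(x,y)\geq t}d_Y(F(x),F(y))\in[0,\infty]$. For nondecreasing nonzero functions $f,g:\mathbb{R}_+\to[0,\infty]$, $f\preceq g$ (equivalently $g\succeq f$) means that there exists $C>0$ such that $f(t)=O(g(Ct))$ as $t\to\infty$. *)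

(* Defs.v *)
From HB Require Import structures.
From mathcomp Require Import all_boot all_order all_algebra.
From mathcomp Require Import all_classical all_reals all_analysis.

Set Implicit Arguments.
Unset Strict Implicit.
Unset Printing Implicit Defensive.
Import Order.TTheory GRing.Theory Num.Theory.
Import numFieldNormedType.Exports.

Local Open Scope classical_set_scope.
Local Open Scope ring_scope.

(* A tree is its vertex set [V], of arbitrary cardinality, with an adjacency
   relation [e] whose degrees may be infinite. A cycle of a simple graph has at
   least three vertices; [ucycle e [:: x; y]] only says that [x] and [y] are
   adjacent. *)
Record simplicial_tree (V : choiceType) (e : rel V) : Prop := SimplicialTree {
  tree_sym : symmetric e;
  tree_irrefl : irreflexive e;
  tree_connected : forall x y : V, exists s : seq V, path e x s /\ last x s = y;
  tree_acyclic : forall c : seq V, ucycle e c -> (size c <= 2)%N }.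

(* [path e x s] is an edge path from [x] to [last x s] with [size s] edges. *)
Definition tree_dist (R : realType) (V : choiceType) (e : rel V) (x y : V) : R :=
  inf [set (size s)%:R | s in [set s : seq V | path e x s /\ last x s = y]].

Definition lp_norm (R : realType) (p : R) (V : choiceType) (u : V -> R) : \bar R :=
  ((\esum_(v in [set: V]) (`|u v| `^ p)%:E) `^ p^-1)%E.

Record lp_space (R : realType) (p : R) (V : choiceType) := LpSpace {
  lp_fun :> V -> R;
  lp_fun_fin : (lp_norm p lp_fun < +oo)%E }.

Lemma esumZl_fin (R : realType) (V : choiceType) (c : R) (a : V -> R) :
  0 <= c -> (forall v, 0 <= a v) -> (\esum_(v in [set: V]) (a v)%:E < +oo)%E ->
  (\esum_(v in [set: V]) (c * a v)%:E < +oo)%E.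
Proof.
move=> c0 a0 aoo.
have a0' : (0 <= \esum_(v in [set: V]) (a v)%:E)%E.
  by apply: esum_ge0 => v _; rewrite lee_fin.
apply: (@le_lt_trans _ _ (c%:E * \esum_(v in [set: V]) (a v)%:E)%E); last first.
  by rewrite lte_mul_pinfty// lee_fin.
apply: ge_ereal_sup => _ /= [A [finA AV] <-].
under eq_fsbigr do rewrite EFinM.
rewrite -ge0_mule_fsumr; last by move=> v; rewrite lee_fin.
by apply: lee_wpmul2l; [rewrite lee_fin|apply: ereal_sup_ubound; exists A].
Qed.

Lemma lp_normB_fin (R : realType) (p : R) (V : choiceType) (u v : lp_space p V) :
  1 <= p -> lp_norm p (u \- v) \is a fin_num.
Proof.
move=> p1; have p0 : 0 < p by exact: lt_le_trans p1.
have fin (w : lp_space p V) : (\esum_(x in [set: V]) (`|w x| `^ p)%:E < +oo)%E.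
  by apply: lty_poweRy (lp_fun_fin w); rewrite invr_neq0// gt_eqF.
have ge0 (w : V -> R) : (0 <= \esum_(x in [set: V]) (`|w x| `^ p)%:E)%E.
  by apply: esum_ge0 => x _; rewrite lee_fin powR_ge0.
rewrite ge0_fin_numE ?poweR_ge0// poweR_lty//.
have : (\esum_(x in [set: V]) ((2 `^ p * (`|u x| `^ p))%:E +
    (2 `^ p * (`|v x| `^ p))%:E) < +oo)%E.
  rewrite esumD; try by move=> x _; rewrite lee_fin mulr_ge0// powR_ge0.
  by apply: lte_add_pinfty; apply: esumZl_fin => // [|x]; exact: powR_ge0.
apply: le_lt_trans; apply: le_esum => x _.
rewrite -EFinD lee_fin -!powRM//.
have h (a b : R) : 0 <= a -> a <= b -> a `^ p <= b `^ p.
  move=> a0 ab; apply: ge0_ler_powR => //; first exact: ltW.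
  by rewrite nnegrE (le_trans a0).
have [uv|/ltW vu] := leP `|u x| `|v x|.
- apply: (le_trans (h _ (2 * `|v x|) _ _)) => //.
    by rewrite mulr_natl mulr2n (le_trans (ler_normB _ _))// lerD2r.
  by rewrite lerDr powR_ge0.
- apply: (le_trans (h _ (2 * `|u x|) _ _)) => //.
    by rewrite mulr_natl mulr2n (le_trans (ler_normB _ _))// lerD2l.
  by rewrite lerDl powR_ge0.
Qed.

(* [fine] is harmless here by [lp_normB_fin]. *)
Definition lp_dist (R : realType) (p : R) (V : choiceType) (u v : lp_space p V) : R :=
  fine (lp_norm p (u \- v)).

Definition uniform_embedding (R : realType) (X Y : Type)
    (dX : X -> X -> R) (dY : Y -> Y -> R) (F : X -> Y) : Prop :=
  forall x y : nat -> X,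
    (dX (x n) (y n) @[n --> \oo] --> +oo) <->
    (dY (F (x n)) (F (y n)) @[n --> \oo] --> +oo).

Definition compression (R : realType) (X Y : Type)
    (dX : X -> X -> R) (dY : Y -> Y -> R) (F : X -> Y) (t : R) : \bar R :=
  ereal_inf [set r | exists x y : X, t <= dX x y /\ r = (dY (F x) (F y))%:E].

(* The constant [K] of the O is required positive, so that [K * +oo = +oo]. *)
Definition asymp_le (R : realType) (f g : R -> \bar R) : Prop :=
  exists2 C : R, 0 < C & exists2 K : R, 0 < K &
    \forall t \near +oo, (f t <= K%:E * g (C * t)%R)%E.

(* Main.v *)
(** Root [T] at a vertex and let [F x] put the weight [w k] on the [k]-th ancestor
    of [x]. Along an edge [F] moves by at most [w 0 ^ p + \sum_k |w (k+1) - w k| ^ p]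
    (to the power [p]), and if [x] and [y] are at distance [d] then one of them has
    at least [d / 2] ancestors that are not ancestors of the other, so that
    [|F x - F y| ^ p >= \sum_(k < d / 2) w k ^ p]. Take
    [w k = 1 + \sum_(1 <= i <= k) ((f i / i) ^ p / i) ^ (1 / p)]: the integral
    condition bounds the increments in [l^p], while for [2 n <= k] the terms
    [n < i <= 2 n] give [w k ^ p >= (f n / 2) ^ p / (2 n)], so the sum over
    [2 n <= k < 4 n] is at least [(f n / 2) ^ p]. *)

Require Import Defs.
From HB Require Import structures.
From mathcomp Require Import all_boot all_order all_algebra.
From mathcomp Require Import all_classical all_reals all_analysis.
From mathcomp Require Import measurable_realfun zify ring lra.

Set Implicit Arguments.
Unset Strict Implicit.
Unset Printing Implicit Defensive.
Import Order.TTheory GRing.Theory Num.Theory.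
Import numFieldNormedType.Exports.

Local Open Scope classical_set_scope.
Local Open Scope ring_scope.

(** * Rooted trees: depth, ancestors and the merging of two branches *)

Section TreeGeometry.
Variables (V : choiceType) (e : rel V) (eT : simplicial_tree e).
Local Open Scope nat_scope.

Let walk_exists (x y : V) :
  exists n, `[< exists s, [/\ path e x s, last x s = y & size s = n] >].
Proof.
have [s [es sy]] := tree_connected eT x y.
by exists (size s); apply/asboolP; exists s.
Qed.

(** The infimum in [tree_dist] is attained; this natural number is its value, open to induction and
    integer arithmetic. *)
Definition gdist (x y : V) : nat := ex_minn (walk_exists x y).

Lemma gdistP (x y : V) :
  exists s, [/\ path e x s, last x s = y & size s = gdist x y].
Proof. by rewrite /gdist; case: ex_minnP => n /asboolP. Qed.

Lemma gdist_le (x y : V) (s : seq V) :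
  path e x s -> last x s = y -> gdist x y <= size s.
Proof.
move=> es sy; rewrite /gdist; case: ex_minnP => n _; apply.
by apply/asboolP; exists s.
Qed.

Lemma tree_distE (R : realType) (x y : V) :
  tree_dist R e x y = ((gdist x y)%:R)%R.
Proof.
rewrite /tree_dist; set S := [set _ | _ in _].
have [s [es sy ss]] := gdistP x y.
have lbS : lbound S ((gdist x y)%:R)%R.
  by move=> _ [t [et ty] <-]; rewrite ler_nat gdist_le.
have Ss : S ((gdist x y)%:R)%R by exists s; rewrite ?ss.
apply/eqP; rewrite eq_le; apply/andP; split.
- by apply: ge_inf => //; exists ((gdist x y)%:R)%R.
- by apply: lb_le_inf => //; exists ((gdist x y)%:R)%R.
Qed.

Variable o : V.

Definition depth (x : V) : nat := gdist o x.

(** The default value makes the root its own parent, so iterates of [parent] are meaningful only up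
    to [depth x]. *)
Definition parent (x : V) : V :=
  xget x [set y | e x y /\ (depth y).+1 = depth x].

(** The last vertex but one on a shortest path from [o] to [x] qualifies: its depth is at most
    [depth x - 1], and any path to it extends by one edge to [x]. *)
Lemma parentP (x : V) :
  0 < depth x -> e x (parent x) /\ (depth (parent x)).+1 = depth x.
Proof.
move=> x0; rewrite /parent; case: xgetP => [y -> //|/= nopar].
have [s [es sx ss]] := gdistP o x; case/lastP: s es sx ss => [|s z].
  by move=> _ _ /= s0; rewrite /depth -s0 in x0.
rewrite rcons_path last_rcons size_rcons => /andP[es ez] zx ss.
rewrite {}zx in ez.
case: (nopar (last o s)); split; first by rewrite (tree_sym eT).
have [t [et tx tt]] := gdistP o (last o s).
apply/eqP; rewrite eqn_leq; apply/andP; split.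
  by rewrite /depth -ss ltnS gdist_le.
rewrite /depth -tt; apply: leq_trans (_ : size (rcons t x) <= _).
  by apply: gdist_le; rewrite ?last_rcons// rcons_path et tx.
by rewrite size_rcons.
Qed.

Lemma depth_eq0 (x : V) : depth x = 0 -> x = o.
Proof.
move=> x0; have [s [_ sx ss]] := gdistP o x.
by rewrite -sx (size0nil (etrans ss x0)).
Qed.

Lemma depth_iter (k : nat) (x : V) :
  k <= depth x -> depth (iter k parent x) = depth x - k.
Proof.
elim: k => [|k IH] kx; first by rewrite subn0.
have kx' := ltnW kx; have := @parentP (iter k parent x).
rewrite IH// subn_gt0 => /(_ kx)[_ /=]; lia.
Qed.

Lemma iter_parent_inj (x : V) (i j : nat) : i <= depth x -> j <= depth x ->
  iter i parent x = iter j parent x -> i = j.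
Proof. by move=> ix jx /(congr1 depth); rewrite !depth_iter//; lia. Qed.

Lemma path_traject (x : V) (k : nat) :
  k <= depth x -> path e x (traject parent (parent x) k).
Proof.
elim: k x => [|k IH] x //= kx.
have [exp dp] := parentP (leq_ltn_trans (leq0n k) kx).
by rewrite exp IH// -ltnS dp.
Qed.

Lemma uniq_traject (x : V) (k : nat) :
  k <= (depth x).+1 -> uniq (traject parent x k).
Proof.
move=> kx; apply/(uniqP x) => i j; rewrite !inE size_traject => ik jk.
rewrite !nth_traject//; apply: iter_parent_inj; rewrite -ltnS.
  exact: leq_trans kx.
exact: leq_trans kx.
Qed.

(** Take the common ancestor of greatest depth [c]; the root is one at depth 0. Equal ancestors have
    equal depth, so none coincide below depth [c], and [a], [b] are the heights of [x] and [y] above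
    [c]. *)
Lemma branches_merge (x y : V) : exists a b,
  [/\ a <= depth x, b <= depth y, iter a parent x = iter b parent y,
      forall i j, i < a -> j <= depth y ->
        iter i parent x != iter j parent y
    & forall i j, i <= depth x -> j < b ->
        iter i parent x != iter j parent y].
Proof.
pose P n := [&& n <= depth x, n <= depth y &
  iter (depth x - n) parent x == iter (depth y - n) parent y].
have P0 : exists n, P n.
  exists 0; rewrite /P !subn0 /=; apply/eqP.
  by rewrite [LHS]depth_eq0 ?[RHS]depth_eq0// depth_iter// subnn.
have Pb n : P n -> n <= depth x by case/and3P.
have [c /and3P[cx cy /eqP cE] cmax] := ex_maxnP P0 Pb.
have merged i j : i <= depth x -> j <= depth y ->
    iter i parent x = iter j parent y ->
    depth x - c <= i /\ depth y - c <= j.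
  move=> ix jy ij; have dE := congr1 depth ij.
  rewrite !depth_iter// in dE.
  have /cmax : P (depth x - i); last by lia.
  rewrite /P leq_subr {1}dE leq_subr /= subKn// dE subKn//.
  exact/eqP.
exists (depth x - c), (depth y - c); split; rewrite ?leq_subr//.
- move=> i j ix jy; apply/eqP => /merged[]//; [|lia].
  exact: leq_trans (ltnW ix) (leq_subr _ _).
- move=> i j ix jy; apply/eqP => /merged[]//; [|lia].
  exact: leq_trans (ltnW jy) (leq_subr _ _).
Qed.

(** Climb from [x] to the common ancestor, then descend to [y]. The first leg already ends at the
    common vertex, so the second leaves it out. *)
Lemma path_through_ancestor (x y : V) (a b : nat) :
  a <= depth x -> b <= depth y -> iter a parent x = iter b parent y ->
  let s := traject parent (parent x) a ++ rev (traject parent y b) in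
  path e x s /\ last x s = y.
Proof.
move=> ax yb abE /=; rewrite cat_path last_cat path_traject//= last_traject.
have belastE : belast y (traject parent (parent y) b) = traject parent y b.
  by elim: b {yb abE} y => //= b IH y; rewrite IH.
split.
  rewrite abE -(last_traject parent) -belastE rev_path.
  rewrite (eq_path (e' := e)); first exact: path_traject.
  by move=> u v; rewrite (tree_sym eT).
case: b {yb belastE} abE => [//|b] _ /=.
by rewrite rev_cons last_rcons.
Qed.

(** Acyclicity enters here; estimates along an edge reduce to estimates along a step to the
    parent. *)
Lemma edge_parent (x y : V) : e x y ->
  (0 < depth x /\ y = parent x) \/ (0 < depth y /\ x = parent y).
Proof.
move=> exy; have [a [b [ax yb abE dx dy]]] := branches_merge x y.
have [es sy] := path_through_ancestor ax yb abE.
set s := _ ++ _ in es sy.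
(* If neither is the parent of the other, the branches close up to a cycle. *)
have : ucycle e (x :: s).
  rewrite /ucycle /= rcons_path es sy (tree_sym eT) exy /=.
  rewrite (_ : _ && _ = uniq (x :: s))// -cat_cons.
  rewrite -[x :: traject _ _ _]/(traject parent x a.+1) cat_uniq.
  rewrite uniq_traject//= rev_uniq uniq_traject ?andbT; last exact: ltnW.
  apply/hasPn => v; rewrite mem_rev => /trajectP[j jb ->].
  have [|//] := boolP (iter j parent y \in traject parent x a.+1).
  move=> /trajectP[i ia ijE].
  by have := dy i j (leq_trans (ia : i <= a) ax) jb; rewrite ijE eqxx.
(* The cycle has [a + b + 1] vertices, hence [a + b <= 1]; and [a = b = 0] would make the edge a
   loop. *)
move/(tree_acyclic eT); rewrite /= size_cat size_rev !size_traject ltnS.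
case: a b ax yb abE {dx dy s es sy} => [|[|a]] [|[|b]] ax yb abE //= _.
- by move: exy; rewrite -[x]/(iter 0 parent x) abE /= (tree_irrefl eT).
- by right.
- by left.
Qed.

End TreeGeometry.

(** * Sums over the vertex set, and an inequality for powers *)

Section EsumSeq.
Variables (R : realType) (V : choiceType).

Lemma sum_le_esum (s : seq V) (u : V -> R) : uniq s ->
  ((\sum_(v <- s) u v)%:E <= \esum_(v in [set: V]) (u v)%:E)%E.
Proof.
move=> us; apply: esum_ge; exists [set` s]; first by split.
by rewrite -sumEFin (fsbig_seq _ _ us).
Qed.

Lemma esum_le_sum (s : seq V) (u : V -> R) : uniq s ->
  (forall v, 0 <= u v) -> (forall v, v \notin s -> u v = 0) ->
  (\esum_(v in [set: V]) (u v)%:E <= (\sum_(v <- s) u v)%:E)%E.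
Proof.
move=> us u0 us0; rewrite -sumEFin (fsbig_seq _ _ us) -esum_fset//; last first.
  by move=> v _; rewrite lee_fin.
rewrite [leRHS]esum_mkcond; apply: le_esum => v _.
by rewrite mem_setE; case: ifPn => // /us0 ->.
Qed.

Lemma sum_traject (f : V -> V) (x : V) (n : nat) (u : V -> R) :
  \sum_(v <- traject f x n) u v = \sum_(k < n) u (iter k f x).
Proof.
elim: n => [|n IH]; first by rewrite big_nil big_ord0.
by rewrite trajectSr -cats1 big_cat big_seq1 IH big_ord_recr.
Qed.

Lemma esumZl_le (c : R) (u : V -> \bar R) : 0 <= c -> (forall v, 0 <= u v)%E ->
  (\esum_(v in [set: V]) (c%:E * u v) <= c%:E * \esum_(v in [set: V]) u v)%E.
Proof.
move=> c0 u0; apply: ge_ereal_sup => _ /= [A [finA _] <-].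
rewrite -ge0_mule_fsumr//; apply: lee_wpmul2l; first by rewrite lee_fin.
by apply: ereal_sup_ubound; exists A.
Qed.

End EsumSeq.

(** The sum [a + b] is at most twice the larger term. *)
Lemma powR_add_le (R : realType) (p a b : R) : 0 <= p -> 0 <= a -> 0 <= b ->
  (a + b) `^ p <= 2 `^ p * (a `^ p + b `^ p).
Proof.
move=> p0 a0 b0.
have le2 (c : R) : 0 <= c -> a + b <= 2 * c ->
    (a + b) `^ p <= 2 `^ p * c `^ p.
  move=> c0 abc; rewrite -powRM//; apply: ge0_ler_powR => //.
    by rewrite nnegrE addr_ge0.
  by rewrite nnegrE mulr_ge0.
have [ab|/ltW ba] := leP a b.
- apply: le_trans (le2 b b0 _) _; first by lra.
  by rewrite ler_wpM2l ?powR_ge0// lerDr powR_ge0.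
- apply: le_trans (le2 a a0 _) _; first by lra.
  by rewrite ler_wpM2l ?powR_ge0// lerDl powR_ge0.
Qed.

(** * The embedding by weighted branches, with lower and upper bounds on its distances *)

Section BranchFunction.
Variables (R : realType) (p : R) (p1 : 1 <= p).
Variables (V : choiceType) (e : rel V) (eT : simplicial_tree e) (o : V).
Variable w : nat -> R.

Local Notation depth := (depth eT o).
Local Notation parent := (parent eT o).

(* The value is [w k] at the [k]-th ancestor of [x], and zero elsewhere. *)
Definition branch (x v : V) : R :=
  if (depth v <= depth x)%N && (iter (depth x - depth v) parent x == v)
  then w (depth x - depth v) else 0.

Lemma branch_iter (x : V) (k : nat) :
  (k <= depth x)%N -> branch x (iter k parent x) = w k.
Proof.
by move=> kx; rewrite /branch depth_iter// leq_subr subKn// eqxx.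
Qed.

Lemma branch_out (x v : V) :
  (forall k, (k <= depth x)%N -> iter k parent x != v) -> branch x v = 0.
Proof.
move=> xv; rewrite /branch; case: andP => // -[_].
by rewrite (negbTE (xv _ _))// leq_subr.
Qed.

Let p0 : 0 < p. Proof. exact: lt_le_trans p1. Qed.

Let p_neq0 : p != 0. Proof. by rewrite gt_eqF. Qed.

(** The support lies in the finite branch from [x] to the root, which has [depth x + 1] vertices. *)
Lemma branch_fin (x : V) : (lp_norm p (branch x) < +oo)%E.
Proof.
rewrite /lp_norm poweR_lty//.
apply: le_lt_trans (ltry (\sum_(v <- traject parent x (depth x).+1)
  `|branch x v| `^ p)).
apply: esum_le_sum => [|v|v vx]; rewrite ?powR_ge0 ?uniq_traject//.
rewrite branch_out ?normr0 ?powR0// => k kx; apply: contraNneq vx => <-.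
by apply/trajectP; exists k.
Qed.

Definition branch_lp (x : V) : lp_space p V := LpSpace (branch_fin x).

(** The [p]-th power of the distance between the images, kept as a sum so that it can be estimated
    vertex by vertex. *)
Definition energy (x y : V) : \bar R :=
  \esum_(v in [set: V]) (`|branch x v - branch y v| `^ p)%:E.

Lemma lp_distE (x y : V) :
  (lp_dist (branch_lp x) (branch_lp y))%:E = (energy x y `^ p^-1)%E.
Proof. by rewrite /lp_dist fineK ?lp_normB_fin. Qed.

Lemma energyC (x y : V) : energy x y = energy y x.
Proof. by apply: eq_esum => v _; rewrite distrC. Qed.

(** Let [m] be the length of the longer leg up to the merge vertex. The path through that vertex has
    at most [2 m] edges, and along the longer leg the other branch function vanishes. *)
Lemma energy_ge_branch (x y : V) : exists2 m : nat, (gdist eT x y <= m.*2)%N &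
  ((\sum_(k < m) `|w k| `^ p)%:E <= energy x y)%E.
Proof.
have [a [b [ax yb abE dx dy]]] := branches_merge eT o x y.
have [es sy] := path_through_ancestor ax yb abE.
have := gdist_le eT es sy; rewrite size_cat size_rev !size_traject => dab.
have [ba|ab] := leqP b a.
- exists a; first by rewrite (leq_trans dab)// -addnn leq_add2l.
  have := @sum_le_esum R V (traject parent x a)
    (fun v => `|branch x v - branch y v| `^ p) (uniq_traject (leqW ax)).
  apply: le_trans; rewrite lee_fin sum_traject; apply: ler_sum => i _.
  rewrite branch_iter ?branch_out ?subr0//.
    by move=> k ky; rewrite eq_sym dx.
  exact: leq_trans (ltnW (ltn_ord i)) ax.
- exists b; first by rewrite (leq_trans dab)// -addnn leq_add2r ltnW.
  rewrite energyC.
  have := @sum_le_esum R V (traject parent y b)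
    (fun v => `|branch y v - branch x v| `^ p) (uniq_traject (leqW yb)).
  apply: le_trans; rewrite lee_fin sum_traject; apply: ler_sum => i _.
  rewrite branch_iter ?branch_out ?subr0//.
    by move=> k ky; rewrite dy.
  exact: leq_trans (ltnW (ltn_ord i)) yb.
Qed.

Variable M : R.
Hypothesis wM : forall n, \sum_(k < n) `|w k.+1 - w k| `^ p <= M.

(** Ancestor number [k + 1] of [x] is ancestor number [k] of [parent x], so the difference there is
    [w (k + 1) - w k]; at [x] itself it is [w 0]. *)
Lemma energy_parent (x : V) : (0 < depth x)%N ->
  (energy x (parent x) <= (`|w 0| `^ p + M)%:E)%E.
Proof.
move=> x0; have [_ dx] := parentP x0.
apply: le_trans (_ : ((\sum_(v <- traject parent x (depth x).+1)
  `|branch x v - branch (parent x) v| `^ p)%:E <= _)%E).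
  apply: esum_le_sum => [|v|v vx]; rewrite ?powR_ge0 ?uniq_traject//.
  rewrite !branch_out ?subr0 ?normr0 ?powR0// => k kx;
    apply: contraNneq vx => <-; apply/trajectP.
    by exists k.+1; rewrite ?iterSr// -dx !ltnS.
  by exists k.
rewrite lee_fin sum_traject big_ord_recl lerD//.
  rewrite -[iter _ _ _]/(iter 0 parent x) branch_iter// branch_out ?subr0//.
  (* Ancestors of [parent x] are less deep than [x], hence distinct from it. *)
  move=> k kx; apply/eqP => /(congr1 depth).
  by rewrite depth_iter// -dx; lia.
apply: le_trans (wM (depth x)); apply: ler_sum => i _.
have idx : (i <= depth (parent x))%N by rewrite -ltnS dx.
by rewrite branch_iter//= -iterS iterSr branch_iter.
Qed.

Lemma energy_triangle (x y z : V) :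
  (energy x z <= (2 `^ p)%:E * (energy x y + energy y z))%E.
Proof.
rewrite -esumD; try by move=> v _; rewrite lee_fin powR_ge0.
apply: (le_trans _ (@esumZl_le R V (2 `^ p) _ _ _)).
- apply: le_esum => v _; rewrite -EFinD -EFinM lee_fin.
  apply: le_trans (powR_add_le (ltW p0) (normr_ge0 _) (normr_ge0 _)).
  apply: ge0_ler_powR; rewrite ?nnegrE ?addr_ge0 ?(ltW p0)//.
  apply: le_trans (ler_normD _ _); rewrite le_eqVlt; apply/orP; left.
  by apply/eqP; congr (`| _ |); ring.
- exact: powR_ge0.
- by move=> v; rewrite -EFinD lee_fin addr_ge0// powR_ge0.
Qed.

(* Exponential in the distance, whereas Minkowski's inequality would give a
   Lipschitz bound; properness only needs a finite bound at each distance. *)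
Fixpoint energy_bound (n : nat) : R :=
  if n is n'.+1 then 2 `^ p * (`|w 0| `^ p + M + energy_bound n') else 0.

Let M0 : 0 <= M. Proof. by have := wM 0; rewrite big_ord0. Qed.

Lemma energy_bound_ge0 (n : nat) : 0 <= energy_bound n.
Proof. by elim: n => //= n IH; rewrite mulr_ge0 ?addr_ge0 ?powR_ge0. Qed.

Lemma energy_bound_nd (m n : nat) :
  (m <= n)%N -> energy_bound m <= energy_bound n.
Proof.
move=> /subnK <-; elim: (n - m)%N => {n}//= n IH; apply: le_trans IH _.
have b0 := energy_bound_ge0 (n + m).
have c0 : 0 <= `|w 0| `^ p + M by rewrite addr_ge0// powR_ge0.
apply: le_trans (_ : `|w 0| `^ p + M + energy_bound (n + m) <= _).
  by rewrite lerDr.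
rewrite -[leLHS]mul1r ler_wpM2r// ?addr_ge0//.
rewrite -[leLHS](powRr0 (2 : R)) ler_powR ?ler1n//.
exact: ltW.
Qed.

Lemma energy_edge (x y : V) : e x y ->
  (energy x y <= (`|w 0| `^ p + M)%:E)%E.
Proof.
move=> /(edge_parent eT o)[[x0 ->]|[y0 ->]]; first exact: energy_parent.
by rewrite energyC energy_parent.
Qed.

Lemma energy_le_bound (x y : V) :
  (energy x y <= (energy_bound (gdist eT x y))%:E)%E.
Proof.
(* Substituting endpoint and distance turns the goal into a bound for every edge path by its length,
   so the induction need not preserve minimality. *)
have [s [es <- <-]] := gdistP eT x y; elim: s x es => [|z s IH] x /=.
  by rewrite /energy esum1// => v _; rewrite subrr normr0 powR0.
move=> /andP[exz es]; apply: le_trans (energy_triangle x z _) _.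
rewrite EFinM lee_wpmul2l ?lee_fin ?powR_ge0// EFinD leeD ?energy_edge//.
exact: IH.
Qed.

End BranchFunction.

(** * Weights built from [f]: the integral condition as a series, and growth of the weights *)

Lemma sum_ge_block (R : realType) (a : nat -> R) (q : R) (l m n : nat) :
  (l <= m)%N -> (m <= n)%N -> (forall i, 0 <= a i) ->
  (forall i, (l <= i < m)%N -> q <= a i) ->
  q *+ (m - l) <= \sum_(i < n) a i.
Proof.
move=> lm mn a0 qa; rewrite -(big_mkord xpredT a).
rewrite (big_cat_nat (n := m))//= (big_cat_nat (n := l) (p := m))//=.
rewrite -sumr_const_nat -[leLHS]addr0 lerD ?sumr_ge0// -[leLHS]add0r.
by rewrite lerD ?sumr_ge0// ler_sum_nat.
Qed.

Section Weights.
Variables (R : realType) (p : R) (p1 : 1 <= p) (f : R -> R).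
Hypothesis f_ge0 : forall t : R, 0 <= t -> 0 <= f t.
Hypothesis f_nd : forall s t : R, 0 <= s -> s <= t -> f s <= f t.
Hypothesis f_int : (\int[lebesgue_measure]_(t in `[1%R, +oo[)
  ((f t / t) `^ p / t)%:E < +oo)%E.

Let p0 : 0 < p. Proof. exact: lt_le_trans p1. Qed.

Let g (t : R) : R := (f t / t) `^ p / t.

(** The density need not be monotone, so [f] is taken at the left end and both denominators at the
    right end. *)
Lemma density_ge (a b t : R) : 0 <= a ->
  a <= t -> 0 < t -> t <= b -> (f a / b) `^ p / b <= (f t / t) `^ p / t.
Proof.
move=> a0 at_ t0 tb; have b0 : 0 < b by exact: lt_le_trans tb.
have b0' := ltW b0; have t0' := ltW t0.
have fat : f a / b <= f t / t.
  by rewrite ler_pM ?f_ge0 ?invr_ge0 ?f_nd ?lef_pV2 ?posrE.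
rewrite ler_pM ?powR_ge0 ?invr_ge0 ?lef_pV2 ?posrE//.
by rewrite ge0_ler_powR ?nnegrE ?divr_ge0 ?f_ge0// ltW.
Qed.

Lemma measurable_density (D : set R) : measurable D -> D `<=` `[1, +oo[ ->
  measurable_fun D g.
Proof.
move=> mD D1; 
(* Since [f] is monotone only on nonnegative reals, clamping the argument at 1 gives functions
   monotone on the whole line that agree with the originals on [D]. *)
pose c (t : R) : R := Num.max 1 t.
have c_nd (s t : R) : s <= t -> c s <= c t.
  by move=> st; rewrite ge_max !le_max lexx st orbT.
have c1 (t : R) : 1 <= c t by rewrite le_max lexx.
have c0 (t : R) : 0 < c t by exact: lt_le_trans (c1 t).
have mh : measurable_fun D (f \o c).
  apply: nondecreasing_measurable => // s t st; apply: f_nd; rewrite ?c_nd//.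
  exact: ltW.
have mV : measurable_fun D (fun t : R => (c t)^-1).
  apply: nonincreasing_measurable => // s t st.
  by rewrite lef_pV2 ?posrE ?c_nd.
apply: (eq_measurable_fun (fun t => ((f \o c) t / c t) `^ p / c t)).
  move=> t /[!inE] /D1; rewrite /= in_itv/= andbT => t1.
  by rewrite /g /c max_r.
apply: measurable_funM => //.
apply: (measurableT_comp (measurable_powR p)).
exact: measurable_funM.
Qed.

(** The cost of doubling both denominators. For [n >= 1] and [t] in [[n, n + 1[] one has [t <= 2 n],
    whence [g n <= c * g t]. *)
Let c : R := 2 `^ p * 2.

(** Each sample is compared with the integral over the unit interval to its right; half-open
    intervals keep the pieces disjoint. *)
Lemma density_sum_le (n : nat) :
  ((\sum_(i < n) g i.+1%:R)%:E <=
   c%:E * \int[lebesgue_measure]_(t in `[1%R, n.+1%:R[) (g t)%:E)%E.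
Proof.
have g0 (t : R) : 1 <= t -> (0 <= (g t)%:E)%E.
  by move=> t1; rewrite lee_fin divr_ge0 ?powR_ge0// (le_trans _ t1).
have c0 : 0 <= c by rewrite mulr_ge0 ?powR_ge0.
elim: n => [|n IH].
  rewrite big_ord0 mule_ge0 ?lee_fin// integral_ge0// => t /=.
  by rewrite in_itv/= => /andP[/g0].
have nS : 1 <= n.+1%:R :> R by rewrite ler1n.
have nSS : n.+1%:R <= n.+2%:R :> R by rewrite ler_nat.
pose A : set R := `[1, n.+1%:R[%classic.
pose B : set R := `[n.+1%:R, n.+2%:R[%classic.
have -> : `[1, n.+2%:R[%classic = A `|` B.
  by apply: itv_bndbnd_setU; rewrite bnd_simp.
have mA : measurable A by exact: measurable_itv.
have mB : measurable B by exact: measurable_itv.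
have B1 (t : R) : B t -> 1 <= t.
  by rewrite /B/= in_itv/= => /andP[t1 _]; exact: le_trans t1.
have A1 (t : R) : A t -> 1 <= t by rewrite /A/= in_itv/= => /andP[].
have mg : measurable_fun (A `|` B) g.
  apply: measurable_density; first exact: measurableU.
  by move=> t /= [/A1|/B1]; rewrite in_itv/= andbT.
have mgB : measurable_fun B (EFin \o g).
  by apply/measurable_EFinP; apply: measurable_funS mg => //; exact: measurableU.
rewrite ge0_integral_setU//=; last 3 first.
- exact/measurable_EFinP.
- by move=> t [/A1|/B1] /g0.
- apply/disj_setPS => t []; rewrite /A/B/= !in_itv/= => /andP[_ t1] /andP[t2 _].
  by move: t1; rewrite ltNge t2.
rewrite big_ord_recr/= EFinD muleDr ?ge0_adde_def ?inE ?integral_ge0//;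
  last 2 first.
- by move=> t /A1/g0.
- by move=> t /B1/g0.
apply: leeD => //.
have : (\int[lebesgue_measure]_(t in B) (c^-1 * g n.+1%:R)%:E
   <= \int[lebesgue_measure]_(t in B) (g t)%:E)%E.
  apply: ge0_le_integral => //.
  - by move=> t _; rewrite lee_fin mulr_ge0 ?invr_ge0// -lee_fin g0.
  - move=> t; rewrite /B/= in_itv/= lee_fin => /andP[t1 t2].
    apply: le_trans (density_ge (b := 2 * n.+1%:R) _ t1 _ _); last 3 first.
    + by [].
    + exact: lt_le_trans t1.
    + by apply: (ltW (lt_le_trans t2 _)); rewrite -natrM ler_nat; lia.
    have -> : g n.+1%:R = c * ((f n.+1%:R / (2 * n.+1%:R)) `^ p / (2 * n.+1%:R)).
      have fE : f n.+1%:R / n.+1%:R = 2 * (f n.+1%:R / (2 * n.+1%:R)) by field.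
      rewrite /g fE powRM// ?divr_ge0 ?f_ge0// /c.
      by field.
    by rewrite mulKf// mulf_neq0// gt_eqF// powR_gt0.
rewrite integral_cst//= lebesgue_measure_itv/= lte_fin ltr_nat ltnSn.
rewrite EFinN -EFinD -EFinM (_ : _ - _ = 1); last by rewrite -natrB// subSnn.
rewrite mulr1 => /(lee_wpmul2l (_ : (0 <= c%:E)%E)); rewrite lee_fin => /(_ c0).
by rewrite -EFinM mulVKf// mulf_neq0// gt_eqF// powR_gt0.
Qed.

Lemma density_sum_bounded :
  exists M : R, forall n, \sum_(i < n) g i.+1%:R <= M.
Proof.
pose I := (\int[lebesgue_measure]_(t in `[1%R, +oo[) (g t)%:E)%E.
have Ioo : (I < +oo)%E by exact: f_int.
have mT : measurable (`[1, +oo[%classic : set R) by exact: measurable_itv.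
have g0 (t : R) : `[1, +oo[%classic t -> (0 <= (g t)%:E)%E.
  rewrite /= in_itv/= andbT => t1.
  by rewrite lee_fin divr_ge0 ?powR_ge0// (le_trans _ t1).
have I0 : (0 <= I)%E by exact: integral_ge0.
exists (c * fine I) => n; rewrite -lee_fin EFinM fineK ?ge0_fin_numE//.
apply: le_trans (density_sum_le n) _.
apply: lee_wpmul2l; first by rewrite lee_fin mulr_ge0 ?powR_ge0.
apply: ge0_subset_integral => //.
- by apply/measurable_EFinP; exact: measurable_density.
- by move=> t /=; rewrite !in_itv/= => /andP[->].
Qed.

(** The root makes the [p]-th powers of the increments sum like the density; the shift starts the
    sampling at 1, where the integral starts. *)
Definition increment (i : nat) : R := g i.+1%:R `^ p^-1.

(* The constant [1] keeps [sum_k weight k ^ p] divergent even if [f] is bounded. *)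
Definition weight (k : nat) : R := 1 + \sum_(i < k) increment i.

Lemma increment_ge0 (i : nat) : 0 <= increment i.
Proof. exact: powR_ge0. Qed.

Lemma weightS (k : nat) : weight k.+1 - weight k = increment k.
Proof. by rewrite /weight big_ord_recr/=; ring. Qed.

Lemma weight_ge1 (k : nat) : 1 <= weight k.
Proof. by rewrite lerDl sumr_ge0// => i _; exact: increment_ge0. Qed.

Lemma weight_increments_bounded :
  exists M : R, forall n, \sum_(k < n) `|weight k.+1 - weight k| `^ p <= M.
Proof.
have [M HM] := density_sum_bounded; exists M => n; apply: le_trans (HM n).
apply: ler_sum => i _.
rewrite weightS ger0_norm ?increment_ge0// -powRrM mulVf ?gt_eqF// powRr1//.
by rewrite divr_ge0 ?powR_ge0.
Qed.

Lemma sum_weight_ge (m : nat) : m%:R <= \sum_(k < m) `|weight k| `^ p.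
Proof.
rewrite -[m in leLHS]card_ord -sumr_const; apply: ler_sum => k _.
apply: le_trans (_ : 1 `^ p <= _); first by rewrite powR1.
rewrite ge0_ler_powR ?nnegrE ?(ltW p0)//.
by rewrite (le_trans (weight_ge1 k)) ?ler_norm.
Qed.

Lemma weight_powR_ge (n k : nat) : (0 < n)%N -> (n.*2 <= k)%N ->
  (f n%:R / 2) `^ p / n.*2%:R <= weight k `^ p.
Proof.
move=> n0 nk.
have n0' : 0 < n%:R :> R by rewrite ltr0n.
have nn0 : 0 < n.*2%:R :> R by rewrite ltr0n double_gt0.
pose d := f n%:R / n.*2%:R.
have d0 : 0 <= d by rewrite divr_ge0 ?f_ge0 // ltW.
(* A common lower bound for the [n] increments with [n <= i < 2 n], whose samples [i + 1] lie in
   []n, 2 n]]; they contribute [n * q] to the weight. *)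
pose q := (d `^ p / n.*2%:R) `^ p^-1.
have dq : 0 <= d `^ p / n.*2%:R by rewrite divr_ge0 ?powR_ge0// ltW.
have -> : (f n%:R / 2) `^ p / n.*2%:R = (n%:R * q) `^ p.
  rewrite [RHS]powRM ?powR_ge0// /q -powRrM mulVf ?gt_eqF// powRr1// mulrA.
  rewrite -powRM// /d -muln2 natrM; congr (_ `^ _ / _).
  by field; rewrite gt_eqF.
rewrite ge0_ler_powR ?nnegrE ?mulr_ge0 ?powR_ge0 ?(ltW p0)//.
  by rewrite (le_trans _ (weight_ge1 k)).
apply: le_trans (_ : \sum_(i < k) increment i <= _); last by rewrite lerDr.
rewrite mulr_natl -[X in _ *+ X](_ : (n.*2 - n = n)%N); last by lia.
apply: sum_ge_block => // [|i|i /andP[ni i2n]].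
- by lia.
- exact: increment_ge0.
rewrite ge0_ler_powR ?nnegrE ?invr_ge0 ?(ltW p0)// ?divr_ge0 ?powR_ge0//.
by apply: density_ge; rewrite ?ltr0n ?ler_nat//; lia.
Qed.

Lemma sum_weight_ge_f (n m : nat) : (0 < n)%N -> (4 * n <= m)%N ->
  (f n%:R / 2) `^ p <= \sum_(k < m) `|weight k| `^ p.
Proof.
move=> n0 nm; have nn0 : 0 < n.*2%:R :> R by rewrite ltr0n double_gt0.
rewrite -[leLHS](divfK (lt0r_neq0 nn0)) mulr_natr.
(* The number of terms in the block cancels the denominator [2 n]. *)
rewrite -[X in _ *+ X](_ : (4 * n - n.*2 = n.*2)%N); last by lia.
apply: (sum_ge_block (a := fun k => `|weight k| `^ p) _ nm) => [|k|k].
- by lia.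
- exact: powR_ge0.
move=> /andP[nk _].
rewrite ger0_norm ?weight_powR_ge//.
exact: le_trans (weight_ge1 k).
Qed.

End Weights.

(** * Properness in both directions and the compression estimate *)

Theorem theorem3 (R : realType) (p : R) (p1 : 1 <= p)
    (V : choiceType) (e : rel V) (eT : simplicial_tree e)
    (f : R -> R)
    (f_ge0 : forall t : R, 0 <= t -> 0 <= f t)
    (f_nd : forall s t : R, 0 <= s -> s <= t -> f s <= f t)
    (f_int : (\int[lebesgue_measure]_(t in `[1%R, +oo[)
                ((f t / t) `^ p / t)%:E < +oo)%E) :
  exists F : V -> lp_space p V,
    uniform_embedding (@tree_dist R V e) (@lp_dist R p V) F /\
    asymp_le (fun t => (f t)%:E)
      (compression (@tree_dist R V e) (@lp_dist R p V) F).
Proof.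
have p0 : 0 < p by exact: lt_le_trans p1.
(* On an empty vertex set the compression is the infimum of the empty set, [+oo]. *)
have [[root _]|noV] := pselect (exists o : V, True); last first.
  have F (v : V) : lp_space p V by case: noV; exists v.
  exists F; split; first by move=> x; case: noV; exists (x 0).
  exists 1 => //; exists 1 => //; near=> t.
  rewrite mul1e mul1r /compression.
  rewrite (_ : [set _ | _] = set0) ?ereal_inf0 ?leey//.
  by apply/seteqP; split => // r [v]; case: noV; exists v.
pose w := weight p f.
have [M wM] := weight_increments_bounded p1 f_ge0 f_nd f_int.
pose F := branch_lp p1 eT root w.
have dist_ge (x y : V) (a : R) : 0 <= a ->
    (a%:E <= energy p eT root w x y)%E -> a `^ p^-1 <= lp_dist (F x) (F y).
  move=> a0 aE; rewrite -lee_fin lp_distE -poweR_EFin.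
  apply: gt0_ler_poweR; rewrite ?invr_ge0 ?(ltW p0) ?in_itv/= ?leey ?lee_fin ?a0//.
  by rewrite (le_trans _ aE) ?lee_fin.
have dist_le (x y : V) :
    lp_dist (F x) (F y) <= energy_bound p w M (gdist eT x y) `^ p^-1.
  rewrite -lee_fin lp_distE -poweR_EFin.
  have := energy_le_bound p1 eT root wM x y => Eb.
  have E0 : (0 <= energy p eT root w x y)%E.
    by apply: esum_ge0 => v _; rewrite lee_fin powR_ge0.
  apply: gt0_ler_poweR; rewrite ?invr_ge0 ?(ltW p0) ?in_itv/= ?leey ?E0//.
  by rewrite (le_trans E0 Eb).
exists F; split.
- move=> x y.
  split => /cvgryPge xy; apply/cvgryPge => A.
  (* The factor 2 offsets [gdist <= 2 m], giving [m >= |A| ^ p]; as all weights are at least 1, the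
     energy is at least [m]. *)
  + have := xy (2 * (Num.truncn (`|A| `^ p)).+1%:R); apply: filterS => n.
    rewrite (tree_distE eT) => dn.
    have [m dm Em] := energy_ge_branch p eT root w (x n) (y n).
    have Am : `|A| `^ p <= m%:R.
      apply: le_trans (ltW (truncnS_gt _)) _.
      move: dn; rewrite -natrM !ler_nat => /leq_trans /(_ dm).
      by rewrite -mul2n leq_pmul2l.
    apply: le_trans (ler_norm A) _.
    apply: le_trans (dist_ge _ _ (`|A| `^ p) (powR_ge0 _ _) _).
      by rewrite -powRrM mulfV ?gt_eqF// powRr1.
    apply: le_trans Em; rewrite lee_fin (le_trans Am)//.
    exact: sum_weight_ge.
  + pose N := Num.truncn A.
    (* Points at distance at most [N] have images no further apart than the root of the bound at
       [N]; the added 1 makes this a contradiction. *)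
    have := xy (energy_bound p w M N `^ p^-1 + 1); apply: filterS => n dn.
    rewrite (tree_distE eT); apply: le_trans (ltW (truncnS_gt _)) _.
    rewrite ler_nat ltnNge; apply/negP => dN.
    have := le_trans dn (dist_le _ _).
    have := energy_bound_nd p1 wM dN => Eb.
    have : energy_bound p w M (gdist eT (x n) (y n)) `^ p^-1 <=
        energy_bound p w M N `^ p^-1.
      rewrite ge0_ler_powR ?nnegrE ?invr_ge0 ?(ltW p0)//;
        exact: energy_bound_ge0.
    by lra.
(* With [n] the integer part of [t] plus one, [t <= n <= 2 t] once [t >= 1]. A distance of at least
   [16 t >= 8 n] forces [m >= 4 n], and 2 absorbs the half in [f n / 2]. *)
- exists 16 => //; exists 2 => //.
  near=> t.
  have t1 : 1 <= t by near: t; exact: nbhs_pinfty_ge.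
  rewrite -lee_pdivrMl// /compression.
  apply: le_ereal_inf_tmp => _ [x [y [dxy ->]]].
  rewrite -EFinM lee_fin mulrC.
  move: dxy; rewrite (tree_distE eT) => dxy.
  have [m dm Em] := energy_ge_branch p eT root w x y.
  pose n := (Num.truncn t).+1.
  have tn : t <= n%:R by exact: ltW (truncnS_gt _).
  have nt : n%:R <= 2 * t.
    have tt : (Num.truncn t)%:R <= t by rewrite truncn_le (le_trans _ t1).
    by rewrite /n -natr1; lra.
  have nm : (4 * n <= m)%N.
    have : (8 * n)%:R <= (gdist eT x y)%:R :> R by rewrite natrM; lra.
    by rewrite ler_nat; lia.
  have t0 : 0 <= t by exact: le_trans t1.
  have fn0 : 0 <= f n%:R / 2 by rewrite divr_ge0 ?f_ge0.
  apply: le_trans (_ : f n%:R / 2 <= _); first by rewrite ler_pM2r ?f_nd.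
  apply: le_trans (dist_ge x y ((f n%:R / 2) `^ p) (powR_ge0 _ _) _).
    by rewrite -powRrM mulfV ?gt_eqF// powRr1.
  apply: le_trans Em; rewrite lee_fin.
  exact: sum_weight_ge_f.
Unshelve. all: by end_near.
Qed.
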